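(* Let $\mu$ be a translation invariant product probability measure on $\mathbb{N}^{\mathbb{Z}}$ (i.e. the heights $\eta(x)$, $x\in\mathbb{Z}$, are i.i.d.) with density $\mathbb{E}_\mu(\eta(0))=1$ and such that $\mu(\eta(0)=0)>0$. Then $\mu$ is not stabilizable.
   Context: Sandpile model on $\mathbb{Z}$ ($d=1$): a configuration $\eta\in\mathbb{N}^{\mathbb{Z}}$ is stable if $\eta(x)\le 1$ for all $x$; toppling an unstable site $x$ (with $\eta(x)\ge 2$) removes 2 grains from $x$ and adds one to each of $x-1,x+1$. A toppling procedure is a measurable map $T:[0,\infty)\times\mathbb{Z}\times\mathbb{N}^{\mathbb{Z}}\to\mathbb{N}$ ($T(t,x,\eta)$ = number of topplings at $x$ up to time $t$) with $T(0,\cdot,\eta)=0$, $t\mapsto T(t,x,\eta)$ right-continuous, nondecreasing, with jumps of size at most one and finitely many jumps in finite time intervals, and with no infinite chain of topplings at neighboring sites $x_1,x_2,\dots$ occurring at decreasing times $t_1>t_2>\cdots$. It is legal if only unstable sites (in the current configuration $\eta_{t-}=\eta-\Delta T(t-,\cdot,\eta)$, $\Delta_{x,y}=2\mathbf{1}_{x=y}-\mathbf{1}_{|x-y|=1}$) topple. A configuration is stabilizable if some legal toppling procedure has $T(\infty,x,\eta)<\infty$ for all $x$ and a stable final configuration $\eta-\Delta T(\infty,\cdot,\eta)$; a measure $\mu$ is stabilizable if $\mu$-a.e. configuration is stabilizable. *)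

(* Defs.v *)
From HB Require Import structures.
From mathcomp Require Import all_boot all_order all_algebra.
From mathcomp Require Import all_classical all_reals all_analysis.
Set Implicit Arguments. Unset Strict Implicit. Unset Printing Implicit Defensive.
Import Order.TTheory GRing.Theory Num.Theory.
Local Open Scope classical_set_scope.
Local Open Scope ring_scope.

Definition config := int -> nat.

(* Cylinder events {eta | eta x = k}; they generate the product sigma-algebra
   on N^Z. *)
Definition cyl_sets : set (set config) :=
  [set A | exists (x : int) (k : nat), A = [set eta : config | eta x = k]].

Definition configSpace := g_sigma_algebraType cyl_sets.

Definition iid_product (R : realType) (mu : probability configSpace R)
  (p : nat -> R) : Prop :=
  forall (s : seq int) (k : int -> nat), uniq s ->
    mu [set eta : configSpace | forall x, x \in s -> eta x = k x]
    = (\prod_(x <- s) p (k x))%:E.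

(* ---- Toppling procedures for a fixed configuration eta ----
   f t x = T(t, x, eta) = number of topplings at x up to time t (t >= 0). *)

Definition left_val (R : realType) (f : R -> int -> nat) (t : R) (x : int)
  (m : nat) : Prop :=
  exists2 d : R, 0 < d & forall s : R, t - d < s -> s < t -> f s x = m.

Definition topples (R : realType) (f : R -> int -> nat) (t : R) (x : int)
  : Prop :=
  0 < t /\ exists m, left_val f t x m /\ (m < f t x)%N.

Definition toppling_procedure (R : realType) (f : R -> int -> nat) : Prop :=
  (forall x, f 0 x = 0%N) /\
  (forall x (s t : R), 0 <= s -> s <= t -> (f s x <= f t x)%N) /\
  (* right-continuous (integer valued, so locally constant to the right) *)
  (forall x (t : R), 0 <= t ->
     exists2 d : R, 0 < d & forall s : R, t <= s -> s < t + d -> f s x = f t x) /\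
  (forall x (t : R), 0 < t ->
     exists m, left_val f t x m /\ (f t x <= m.+1)%N) /\
  (forall x (T : R), 0 <= T -> exists n : nat,
     forall ts : seq R, uniq ts ->
       (forall t, t \in ts -> (t <= T /\ topples f t x)) -> (size ts <= n)%N) /\
  ~ (exists (xs : nat -> int) (ts : nat -> R),
       forall n, `|xs n.+1 - xs n| = 1 /\ ts n.+1 < ts n /\
                 topples f (ts n) (xs n)).

(* current configuration eta_{t-} = eta - Delta T(t-) at site x, given left
   limits mx, ml, mr of T at x, x-1, x+1 *)
Definition legal (R : realType) (eta : config) (f : R -> int -> nat) : Prop :=
  forall (t : R) (x : int) (mx ml mr : nat),
    0 < t -> left_val f t x mx -> left_val f t (x - 1) ml ->
    left_val f t (x + 1) mr -> (mx < f t x)%N ->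
    2 <= (eta x)%:Z - 2 * mx%:Z + ml%:Z + mr%:Z.

Definition stabilizable (R : realType) (eta : config) : Prop :=
  exists f : R -> int -> nat,
    toppling_procedure f /\ legal eta f /\
    exists Tinf : int -> nat,
      (forall x, exists t0 : R, forall t, t0 <= t -> f t x = Tinf x) /\
      (forall x, (eta x)%:Z - 2 * (Tinf x)%:Z + (Tinf (x - 1))%:Z
                   + (Tinf (x + 1))%:Z <= 1).

(* Main.v *)
Require Import Defs.
From HB Require Import structures.
From mathcomp Require Import all_boot all_order all_algebra zify.
From mathcomp Require Import all_classical all_reals all_analysis measurable_realfun.
Import Order.TTheory GRing.Theory Num.Theory.
Local Open Scope classical_set_scope.
Local Open Scope ring_scope.

(** If [eta] is stabilizable then some [u : Z -> N] satisfies
    [eta + Laplacian u <= 1] everywhere; there is a least such [u], the odometer,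
    and by leastness [eta + Laplacian u] takes values in [{0, 1}].  The odometer is
    a translation covariant function of [eta], so its gradient is stationary, and
    its Laplacian, being integrable, has mean zero.  With mean height [1] this
    forces [eta + Laplacian u = 1] almost surely.  Independence then gives one
    [eta] such that this holds both after setting [eta 0] to [0] and after
    setting it to some [k >= 1] of positive probability.  The difference [w >= 0]
    of the two odometers has Laplacian [- k] at the origin and [0] elsewhere, so
    it is concave and not affine on [Z], hence not bounded below. *)

(** * The odometer as least stabilizing function *)

Definition stable_after (eta : config) (u : int -> nat) (x : int) : Prop :=
  (eta x + u (x - 1)%R + u (x + 1)%R <= 1 + 2 * u x)%N.

Definition stabilizes (eta : config) (u : int -> nat) : Prop :=
  forall x, stable_after eta u x.

(* Boxes make the odometer measurable: [box_le n x k] depends on finitely many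
   heights, and by compactness the odometer at [x] is at most [k] iff all
   [box_le n x k] hold. *)
Definition box_le (n : nat) (x : int) (k : nat) : set configSpace :=
  [set eta | exists2 u : int -> nat,
     forall y : int, `|y| <= n%:Z -> stable_after eta u y & (u x <= k)%N].

Definition odometer_le (eta : config) (x : int) (k : nat) : Prop :=
  forall n, box_le n x k eta.

(* Junk value [0] when no [k] bounds the toppling at [x]. *)
Definition odometer (eta : config) (x : int) : nat :=
  if pselect (exists k, `[< odometer_le eta x k >]) is left h
  then ex_minn h else 0%N.

Lemma box_le_monotone {n m x j k eta} :
  (n <= m)%N -> (j <= k)%N -> box_le m x j eta -> box_le n x k eta.
Proof.
move=> nm jk [u su uj]; exists u; last exact: leq_trans uj jk.
by move=> y yn; apply: su; apply: le_trans yn _; rewrite lez_nat.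
Qed.

Lemma stabilizes_odometer_le {eta u} x :
  stabilizes eta u -> odometer_le eta x (u x).
Proof. by move=> su n; exists u. Qed.

Lemma odometer_min eta x k : odometer_le eta x k -> (odometer eta x <= k)%N.
Proof.
move=> ek; rewrite /odometer; case: pselect => //= h.
by case: ex_minnP => m _; apply; exact/asboolP.
Qed.

Lemma odometerP {eta x k} : odometer_le eta x k -> odometer_le eta x (odometer eta x).
Proof.
move=> ek; rewrite /odometer; case: pselect => /= [h|[]].
  by case: ex_minnP => m /asboolP.
by exists k; apply/asboolP.
Qed.

Lemma odometer_le_least {eta u} x :
  stabilizes eta u -> (odometer eta x <= u x)%N.
Proof. by move=> su; apply: odometer_min; exact: stabilizes_odometer_le. Qed.

(** Leastness at [x] is already enforced by a finite box: if the odometer is [k.+1], the bound [k]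
    fails in some box, hence in every larger one. *)
Lemma box_ge_odometer eta x : exists n, forall m u, (n <= m)%N ->
  (forall y : int, `|y| <= m%:Z -> stable_after eta u y) ->
  (odometer eta x <= u x)%N.
Proof.
case E : (odometer eta x) => [|k]; first by exists 0%N.
have : ~ odometer_le eta x k by move/odometer_min; rewrite E ltnn.
move/existsNP => [n nk]; exists n => m u nm su; rewrite ltnNge; apply/negP => uk.
by apply: nk; apply: (box_le_monotone nm uk); exists u.
Qed.

(** For each [x], compare with one [v] that stabilizes a large box: [v] is at most the odometer at
    [x] and at least the odometer at both neighbours, so stability of [v] at [x] passes to the
    odometer. *)
Lemma odometer_stabilizes eta u :
  stabilizes eta u -> stabilizes eta (odometer eta).
Proof.
move=> su x.
have [n1 h1] := box_ge_odometer eta (x - 1).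
have [n2 h2] := box_ge_odometer eta (x + 1).
(* This radius exceeds both thresholds and puts [x] inside the box. *)
have [v sv vx] := odometerP (stabilizes_odometer_le x su) (n1 + n2 + `|x|)%N.
have := h1 _ v _ sv; have := h2 _ v _ sv.
have := sv x; rewrite /stable_after.
have -> : `|x| <= (n1 + n2 + `|x|)%N%:Z by lia.
move=> /(_ isT) sx /(_ ltac:(lia)) a /(_ ltac:(lia)) b; lia.
Qed.

(* Otherwise one toppling at [x] could be saved. *)
Lemma odometer_laplacian_ge0 eta u x : stabilizes eta u ->
  (2 * odometer eta x
     <= eta x + odometer eta (x - 1)%R + odometer eta (x + 1)%R)%N.
Proof.
move=> /odometer_stabilizes; set v := odometer eta => sv.
rewrite leqNgt; apply/negP => lt.
(* By [lt], [v x] is positive and the final height at [x] is negative. Lowering [v x] by one raises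
   that height by 2, to at most 1, and lowers the heights at both neighbours. *)
pose w y := if y == x then (v x).-1 else v y.
have sw : stabilizes eta w.
  have wv y : (w y <= v y)%N by rewrite /w; case: eqP => // ->; exact: leq_pred.
  move=> y; have := sv y; rewrite /stable_after.
  have := wv (y - 1); have := wv (y + 1); rewrite [w y]/w.
  by case: eqP => [->|_]; lia.
by have := odometer_le_least x sw; rewrite /w eqxx -/v; lia.
Qed.

(** * Translation covariance of the odometer *)

Definition translate (a : int) (eta : config) : config := fun x => eta (x + a).

Lemma stabilizes_translate a eta u :
  stabilizes eta u -> stabilizes (translate a eta) (fun x => u (x + a)).
Proof.
by move=> su x; have := su (x + a); rewrite /stable_after /translate ![_ + a + _]addrAC.
Qed.

(** The boxes are centred at 0, so covariance is not visible on them; it follows from leastness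
    applied to each odometer shifted onto the other configuration. *)
Lemma odometer_translate a eta u x : stabilizes eta u ->
  odometer (translate a eta) x = odometer eta (x + a).
Proof.
move=> su; apply/eqP; rewrite eqn_leq; apply/andP; split.
  exact: odometer_le_least x (stabilizes_translate a _ _ (odometer_stabilizes _ _ su)).
have sv := odometer_stabilizes _ _ (stabilizes_translate a _ _ su).
have := odometer_le_least (x + a) (_ : stabilizes eta (fun y => odometer (translate a eta) (y - a))).
rewrite addrK; apply; move=> y.
have := stabilizes_translate (- a) _ _ sv y; rewrite /stable_after /translate subrK; exact.
Qed.

(** * Changing the height at the origin *)

Definition set_origin (k : nat) (eta : config) : config :=
  fun x => if x == 0 then k else eta x.

Lemma nat_valued_not_concave (w : int -> nat) (k : nat) : (0 < k)%N ->
  ~ forall x : int, (w (x - 1)%R + w (x + 1)%R + (if x == 0%R then k else 0)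
                   = 2 * w x)%N.
Proof.
move=> k0 hw.
have w0 : (w (-1)%R + w 1%R + k = 2 * w 0%R)%N by have := hw 0; rewrite eqxx sub0r add0r.
have wp (n : nat) : (w n%:Z + w n.+2%:Z = 2 * w n.+1%:Z)%N.
  have := hw n.+1%:Z; rewrite addn0.
  by rewrite (_ : n.+1%:Z - 1 = n%:Z) 1?(_ : n.+1%:Z + 1 = n.+2%:Z); lia.
have wn (n : nat) : (w (- n.+2%:Z)%R + w (- n%:Z)%R = 2 * w (- n.+1%:Z)%R)%N.
  have := hw (- n.+1%:Z); rewrite addn0.
  by rewrite (_ : - n.+1%:Z - 1 = - n.+2%:Z) 1?(_ : - n.+1%:Z + 1 = - n%:Z); lia.
(* The symmetrized function [w n + w (- n)] falls by [k] at each step; two consecutive values are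
   carried because the recurrence has order two. *)
have step (n : nat) : (w n.+1%:Z + w (- n.+1%:Z)%R + k * n.+1 = 2 * w 0%R)%N /\
    (w n%:Z + w (- n%:Z)%R + k * n = 2 * w 0%R)%N.
  elim: n => [|n [IH1 IH0]].
    rewrite oppr0; move: w0; rewrite -[w 1]/(w 1%N%:Z) addnC.
    by move: (w _) (w _) (w _) => a b c; lia.
  split=> //; have := wp n; have := wn n; move: IH0 IH1.
  move: (w _) (w _) (w _) (w _) (w _) (w _) (w _) => *; nia.
(* At this [n] the term [k * n] exceeds [2 * w 0]. *)
have [_ ] := step (2 * w 0%R).+1; nia.
Qed.

Definition stabilizes_to_one (eta : config) : Prop :=
  forall x, (eta x + odometer eta (x - 1)%R + odometer eta (x + 1)%R
             = 1 + 2 * odometer eta x)%N.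

(** The odometer for height [k] also stabilizes the smaller configuration, so it dominates the
    odometer for [j]. Both final configurations equal 1, so the difference has Laplacian [j - k] at
    the origin and 0 elsewhere. *)
Lemma stabilizes_to_one_set_origin eta j k : (j < k)%N ->
  stabilizes_to_one (set_origin j eta) -> ~ stabilizes_to_one (set_origin k eta).
Proof.
move=> jk eu eu'.
have sv : stabilizes (set_origin j eta) (odometer (set_origin k eta)).
  move=> x; have := eu' x; rewrite /stable_after /set_origin; case: eqP => _; lia.
have le x := odometer_le_least x sv.
pose w x := (odometer (set_origin k eta) x - odometer (set_origin j eta) x)%N.
apply: (@nat_valued_not_concave w (k - j)); first by rewrite subn_gt0.
move=> x; have := eu x; have := eu' x; rewrite /w.
rewrite [set_origin k eta x]/set_origin [set_origin j eta x]/set_origin.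
move: (le x) (le (x - 1)) (le (x + 1)).
move: (odometer _ _) (odometer _ _) (odometer _ _) (odometer _ _) => a b c d.
move: (odometer _ _) (odometer _ _) => e f.
by case: (x == 0); lia.
Qed.

(** The second alternative accounts for the junk value 0, so that the odometer is measurable on the
    whole space. *)
Lemma odometer_leE eta x k :
  (odometer eta x <= k)%N <-> odometer_le eta x k \/ forall j, ~ odometer_le eta x j.
Proof.
split=> [ok|[/odometer_min //|no]]; last first.
  rewrite /odometer; case: pselect => //= h.
  by exfalso; case: h => j /asboolP /no.
have [[j ej]|/forallNP no] := pselect (exists j, odometer_le eta x j); last by right.
by left=> n; apply: box_le_monotone (leqnn n) ok _; exact: (odometerP ej).
Qed.

(** * Measurability *)

(** The target carries the discrete sigma-algebra, so composing with any map out of [C] preserves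
    the property. *)
Definition discretely_measurable {C : Type} (f : configSpace -> C) : Prop :=
  forall B : set C, measurable (f @^-1` B).

Lemma discretely_measurable_fibers {C : countType} (f : configSpace -> C) :
  (forall c, measurable (f @^-1` [set c])) -> discretely_measurable f.
Proof.
move=> mf B; rewrite (_ : f @^-1` B = \bigcup_c (f @^-1` (B `&` [set c]))).
  apply: countable_bigcupT_measurable => [|c]; first exact: countableP.
  have [Bc|Bc] := pselect (B c).
    by rewrite (_ : _ `&` _ = [set c]) //; apply/seteqP; split=> [y []|_ ->].
  rewrite (_ : _ `&` _ = set0) ?preimage_set0 //.
  by apply/seteqP; split=> // y [By yc]; apply: Bc; rewrite -yc.
by apply/seteqP; split=> [eta Beta|eta [c _ []]]; first by exists (f eta).
Qed.

Lemma discretely_measurable_pair {C D : countType} (f : configSpace -> C)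
    (g : configSpace -> D) :
  discretely_measurable f -> discretely_measurable g ->
  discretely_measurable (fun eta => (f eta, g eta)).
Proof.
move=> mf mg; apply: discretely_measurable_fibers => -[c d].
rewrite (_ : _ @^-1` _ = f @^-1` [set c] `&` g @^-1` [set d]).
  by apply: measurableI; [exact: mf|exact: mg].
by apply/seteqP; split=> eta /= [-> ->].
Qed.

Lemma discretely_measurable_fun d (T : measurableType d) (f : configSpace -> T) :
  discretely_measurable f -> measurable_fun setT f.
Proof. by move=> mf _ B _; rewrite setTI; exact: mf. Qed.

Lemma discretely_measurable_eval (x : int) :
  discretely_measurable (fun eta : configSpace => eta x).
Proof.
apply: discretely_measurable_fibers => k; apply: sub_sigma_algebra.
by exists x, k.
Qed.

(** Such an event is a preimage under the map to the list of heights on [s], whose values are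
    countable. *)
Lemma measurable_finitely_determined (s : seq int) (A : set configSpace) :
  (forall eta eta' : configSpace,
     {in s, forall x, eta x = eta' x} -> A eta -> A eta') ->
  measurable A.
Proof.
move=> As.
have mmap : discretely_measurable (fun eta : configSpace => map eta s).
  elim: s {As} => [|x s IH] B /=.
    by have [?|?] := pselect (B [::]);
      [rewrite preimage_cst mem_set|rewrite preimage_cst memNset].
  exact: (discretely_measurable_pair _ _ (discretely_measurable_eval x) IH
    [set y | B (y.1 :: y.2)]).
rewrite (_ : A = (fun eta : configSpace => map eta s) @^-1`
                   [set l | exists2 eta, A eta & map eta s = l]); first exact: mmap.
apply/seteqP; split=> [eta Aeta|eta [eta' Aeta' /eq_in_map e]]; first by exists eta.
exact: As Aeta'.
Qed.

Definition int_ball (n : nat) : seq int :=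
  [seq i%:Z - n%:Z | i <- iota 0 (n + n).+1].

Lemma mem_int_ball n (x : int) : `|x| <= n%:Z -> x \in int_ball n.
Proof.
move=> xn; apply/mapP; exists (absz (x + n%:Z)); last by lia.
by rewrite mem_iota; lia.
Qed.

Lemma measurable_box_le n x k : measurable (box_le n x k).
Proof.
apply: (measurable_finitely_determined (int_ball n)) => eta eta' e [u su uk].
exists u => // y yn; rewrite /stable_after -(e y); first exact: su.
exact: mem_int_ball.
Qed.

Lemma discretely_measurable_odometer x :
  discretely_measurable (fun eta : configSpace => odometer eta x).
Proof.
have mle k : measurable [set eta : configSpace | odometer_le eta x k].
  rewrite (_ : [set _ | _] = \bigcap_n box_le n x k).
    by apply: bigcapT_measurable => n; exact: measurable_box_le.
  by apply/seteqP; split=> eta /= h n; [move=> _|]; exact: h.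
have mo k : measurable [set eta : configSpace | (odometer eta x <= k)%N].
  rewrite (_ : [set _ | _] = [set eta | odometer_le eta x k] `|`
      \bigcap_j ~` [set eta | odometer_le eta x j]).
    apply: measurableU => //; apply: bigcapT_measurable => j.
    exact: measurableC.
  apply/seteqP; split=> eta /=.
    by move/odometer_leE => [?|no]; [left|right => j _; exact: no].
  by move=> h; apply/odometer_leE; case: h => [?|no]; [left|right => j; exact: no].
apply: discretely_measurable_fibers => -[|k].
  rewrite (_ : _ @^-1` _ = [set eta | (odometer eta x <= 0)%N]) //.
  by apply/seteqP; split=> eta /=; [move=> ->|rewrite leqn0 => /eqP].
rewrite (_ : _ @^-1` _ = [set eta | (odometer eta x <= k.+1)%N] `\`
                         [set eta | (odometer eta x <= k)%N]).
  exact: measurableD.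
apply/seteqP; split=> eta /=; first by move=> ->; rewrite leqnn ltnn.
by case=> ? ?; lia.
Qed.

Lemma measurable_config_map (f : configSpace -> configSpace) :
  (forall x, discretely_measurable (fun eta => f eta x)) ->
  measurable_fun setT f.
Proof.
move=> mf; apply: (measurability (cyl_sets : set (set configSpace))) => //.
move=> _ [_ [x [k ->]] <-].
by rewrite setTI; exact: mf [set k].
Qed.

Lemma measurable_translate a : measurable_fun setT (translate a : configSpace -> configSpace).
Proof. by apply: measurable_config_map => x; exact: discretely_measurable_eval. Qed.

Lemma measurable_set_origin k :
  measurable_fun setT (set_origin k : configSpace -> configSpace).
Proof.
apply: measurable_config_map => x B; rewrite /set_origin.
case: (x == 0); last exact: discretely_measurable_eval.
by rewrite preimage_cst; case: ifP.
Qed.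

Definition cylinder (s : seq int) (k : int -> nat) : set configSpace :=
  [set eta | forall x, x \in s -> eta x = k x].

Lemma measurable_cylinder s k : measurable (cylinder s k).
Proof.
apply: (measurable_finitely_determined s) => eta eta' e h x xs.
by rewrite -e // h.
Qed.

(** Cylinders together with the empty set form a generating pi-system. *)
Lemma eq_measure_cylinder (R : realType)
    (m1 m2 : {measure set configSpace -> \bar R}) :
  (m1 setT < +oo)%E ->
  (forall s k, uniq s -> m1 (cylinder s k) = m2 (cylinder s k)) ->
  forall A, measurable A -> m1 A = m2 A.
Proof.
move=> fin e.
have cylT k : cylinder [::] k = setT by apply/seteqP; split.
pose G := [set A | A = set0 \/ exists s k, A = cylinder s k].
apply: (@measure_unique _ _ _ G (fun=> setT)).
- rewrite eqEsubset; split=> A.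
    apply: smallest_sub; first exact: smallest_sigma_algebra.
    move=> _ [x [k ->]]; apply: sub_sigma_algebra; right.
    exists [:: x], (fun=> k); apply/seteqP; split=> eta /=.
      by move=> <- y /[!inE] /eqP ->.
    by apply; rewrite inE.
  apply: smallest_sub; first exact: sigma_algebra_measurable.
  by move=> _ [->|[s [k ->]]] //; exact: measurable_cylinder.
- move=> _ _ [->|[s [k ->]]] [->|[s' [k' ->]]];
    rewrite ?set0I ?setI0; do ?by left.
  (* Any common point [eta] prescribes the heights of the intersection on [s ++ s']; conflicting
     prescriptions give the empty set. *)
  have [[eta [h h']]|no] := pselect (exists eta, (cylinder s k `&` cylinder s' k') eta).
    right; exists (s ++ s'), eta; apply/seteqP; split=> eta' /=.
      by move=> [g g'] x; rewrite mem_cat => /orP[] xs; [rewrite g ?h|rewrite g' ?h'].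
    by move=> g; split=> x xs; rewrite g ?mem_cat ?xs ?orbT //; [exact: h|exact: h'].
  by left; apply/seteqP; split=> // eta h; apply: no; exists eta.
- by move=> _; right; exists [::], (fun=> 0%N); rewrite cylT.
- by rewrite bigcup_const.
- move=> _ [->|[s [k ->]]]; first by rewrite !measure0.
  rewrite (_ : cylinder s k = cylinder (undup s) k); last first.
    by apply/seteqP; split=> eta h x xs; apply: h; rewrite ?mem_undup // -mem_undup.
  by apply: e; exact: undup_uniq.
- by move=> _.
Qed.

(** * Translation invariance and finite energy *)

Section IidProduct.
Context {R : realType} {mu : probability configSpace R} {p : nat -> R}.
Hypothesis mu_iid : iid_product mu p.

Lemma mu_cylinder s k : uniq s -> mu (cylinder s k) = (\prod_(x <- s) p (k x))%:E.
Proof. by move=> us; exact: mu_iid. Qed.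

Lemma mu_eval x k : mu [set eta : configSpace | eta x = k] = (p k)%:E.
Proof.
have := mu_cylinder [:: x] (fun=> k) isT; rewrite big_seq1 => <-; congr (mu _).
apply/seteqP; split=> eta /=; first by move=> <- y /[!inE] /eqP ->.
by apply; rewrite inE.
Qed.

Lemma p_ge0 k : 0 <= p k.
Proof. by rewrite -lee_fin -(mu_eval 0). Qed.

Lemma mu_translate a (A : set configSpace) : measurable A -> mu (translate a @^-1` A) = mu A.
Proof.
move=> mA; pose m := measure_function_pushforward__canonical__measure_function_Measure
  mu (measurable_translate a).
apply: (eq_measure_cylinder _ m mu _ _ A mA) => [|s k us].
  by rewrite /m /= /pushforward preimage_setT probability_setT ltry.
rewrite /m /= /pushforward (_ : _ @^-1` _ = cylinder [seq x + a | x <- s] (fun x => k (x - a))).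
  rewrite !mu_cylinder ?map_inj_uniq //; last exact: addIr.
  by rewrite big_map; congr EFin; apply: eq_bigr => x _; rewrite addrK.
apply/seteqP; split=> eta h x.
  by move=> /mapP[y ys ->]; rewrite addrK -h.
by move=> xs; rewrite /translate h ?addrK //; exact: map_f.
Qed.

(** Independence: the preimage ignores the height at 0, and [set_origin k] is the identity on the
    event that this height is [k]. Both sides are finite measures in [A], compared on cylinders. *)
Lemma mu_set_origin k (A : set configSpace) : measurable A ->
  ((p k)%:E * mu (set_origin k @^-1` A))%E =
  mu (A `&` [set eta : configSpace | eta 0 = k]).
Proof.
move=> mA.
have mk : measurable [set eta : configSpace | eta 0 = k].
  exact: discretely_measurable_eval 0 [set k].
pose m0 := measure_function_pushforward__canonical__measure_function_Measure
  mu (measurable_set_origin k).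
pose m1 := mscale (NngNum (p_ge0 k)) m0.
pose m2 := mrestr mu mk.
apply: (eq_measure_cylinder _ m1 m2 _ _ A mA) => [|s l us].
  rewrite /m1 /m0 /= /mscale /= /pushforward preimage_setT probability_setT.
  by rewrite mule1 ltry.
rewrite /m1 /m2 /m0 /= /mscale /mrestr /= /pushforward.
(* Three cases: the origin is unconstrained, constrained to another height (both sides vanish), or
   constrained to [k]. *)
have [s0|s0] := boolP (0 \in s); last first.
  rewrite (_ : _ @^-1` _ = cylinder s l); last first.
    apply/seteqP; split=> eta h x xs; have := h x xs; rewrite /set_origin;
      by case: eqP xs => // ->; rewrite (negPf s0).
  rewrite (_ : _ `&` _ = cylinder (0 :: s) (fun x => if x == 0 then k else l x)).
    rewrite !mu_cylinder //= ?s0 // big_cons eqxx; congr EFin; congr (_ * _).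
    by apply: eq_big_seq => x; case: eqP => // ->; rewrite (negPf s0).
  apply/seteqP; split=> eta.
    by move=> [h h0] x; rewrite inE; case: eqP => [->|_ /h].
  move=> h; split; last by apply: h; rewrite inE eqxx.
  move=> x xs; have := h x; rewrite inE xs orbT => /(_ isT) ->.
  by case: eqP xs => // ->; rewrite (negPf s0).
have [lk|lk] := eqVneq (l 0) k; last first.
  rewrite (_ : _ @^-1` _ = set0); last first.
    apply/seteqP; split=> // eta /(_ 0 s0); rewrite /set_origin eqxx => kl.
    by rewrite kl eqxx in lk.
  rewrite (_ : _ `&` _ = set0) ?measure0 ?mule0 //.
  apply/seteqP; split=> // eta [/(_ 0 s0) l0 /= kl].
  by rewrite -l0 kl eqxx in lk.
rewrite (_ : _ @^-1` _ = cylinder (rem 0 s) l); last first.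
  apply/seteqP; split=> eta h x; rewrite ?mem_rem_uniq // ?inE.
    by move=> /andP[/negPf x0 xs]; rewrite -h // /set_origin x0.
  move=> xs; rewrite /set_origin; case: eqP => [->//|/eqP x0].
  by apply: h; rewrite mem_rem_uniq // inE x0.
rewrite (_ : _ `&` _ = cylinder s l).
  rewrite !mu_cylinder ?rem_uniq // -EFinM; congr EFin.
  by rewrite [RHS](perm_big _ (perm_to_rem s0)) big_cons lk.
by apply/seteqP; split=> eta; [case|move=> h; split=> //=; rewrite h].
Qed.

Lemma ae_translate a (P : config -> Prop) :
  {ae mu, forall eta, P eta} -> {ae mu, forall eta, P (translate a eta)}.
Proof.
move=> [N [mN N0 PN]]; exists (translate a @^-1` N); split.
- by rewrite -[X in measurable X]setTI; exact: measurable_translate.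
- by rewrite mu_translate.
- by move=> eta nP; exact: PN.
Qed.

(** For a null set [N], [p k] times the measure of its preimage is at most [mu N = 0], and [p k] is
    positive. *)
Lemma ae_set_origin k (P : config -> Prop) : 0 < p k ->
  {ae mu, forall eta, P eta} -> {ae mu, forall eta, P (set_origin k eta)}.
Proof.
move=> pk [N [mN N0 PN]]; exists (set_origin k @^-1` N); split.
- by rewrite -[X in measurable X]setTI; exact: measurable_set_origin.
- have : ((p k)%:E * mu (set_origin k @^-1` N) <= 0)%E.
    rewrite mu_set_origin // -N0; apply: le_measure; rewrite ?inE //.
    by apply: measurableI => //; exact: discretely_measurable_eval 0 [set k].
  rewrite pmule_rle0 ?lte_fin // => le0.
  by apply/eqP; rewrite eq_le le0 measure_ge0.
- by move=> eta nP; exact: PN.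
Qed.

End IidProduct.

(** * The mean of the odometer's Laplacian *)

(** Truncation to [[-n, n]]: bounded, hence integrable after composition, and 1-Lipschitz, so
    increments do not grow. *)
Definition clamp (n : nat) (z : int) : int := Num.max (- n%:Z) (Num.min n%:Z z).

Lemma clamp_id n z : `|z| <= n%:Z -> clamp n z = z.
Proof. by rewrite /clamp; lia. Qed.

Lemma clamp_bounded n z : `|clamp n z| <= n%:Z.
Proof. by rewrite /clamp; lia. Qed.

Lemma clamp_lipschitz n y z : `|clamp n y - clamp n z| <= `|y - z|.
Proof. by rewrite /clamp; lia. Qed.

Definition gradient (eta : config) (x : int) : int :=
  (odometer eta x)%:Z - (odometer eta (x - 1))%:Z.

Lemma discretely_measurable_gradient x :
  discretely_measurable (fun eta : configSpace => gradient eta x).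
Proof.
move=> B.
exact: (discretely_measurable_pair _ _ (discretely_measurable_odometer x)
  (discretely_measurable_odometer (x - 1)) [set y | B (y.1%:Z - y.2%:Z)]).
Qed.

#[local] Instance ae_configSpace_filter (R : realType)
    (mu : probability configSpace R) : Filter (nbhs (almost_everywhere mu)).
Proof. exact: ae_filter_ringOfSetsType. Qed.

Section StationaryGradient.
Context {R : realType} {mu : probability configSpace R} {p : nat -> R}.
Hypothesis mu_iid : iid_product mu p.
Hypothesis mean1 : (\int[mu]_eta ((eta : configSpace) 0%:Z)%:R%:E = 1)%E.
Hypothesis ae_stabilizes : {ae mu, forall eta, exists u, stabilizes eta u}.

Lemma integral_translate a (f : configSpace -> \bar R) :
  measurable_fun [set: configSpace] f -> mu.-integrable [set: configSpace] (f \o translate a) ->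
  (\int[mu]_eta f (translate a eta) = \int[mu]_eta f eta)%E.
Proof.
move=> mf intf.
rewrite -[LHS](integral_pushforward (measurable_translate a) mf intf measurableT).
pose m := measure_function_pushforward__canonical__measure_function_Measure
  mu (measurable_translate a).
by apply: (@eq_measure_integral _ _ _ _ mu m) => A mA _; exact: mu_translate mu_iid a A mA.
Qed.

Lemma measurable_intr_EFin (f : configSpace -> int) : discretely_measurable f ->
  measurable_fun [set: configSpace] (fun eta => (f eta)%:~R%:E : \bar R).
Proof.
move=> mf; apply: discretely_measurable_fun => B.
exact: mf [set z | B z%:~R%:E].
Qed.

Lemma integrable_bounded_int (f : configSpace -> int) (n : nat) :
  discretely_measurable f -> (forall eta, `|f eta| <= n%:Z) ->
  mu.-integrable setT (fun eta => (f eta)%:~R%:E).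
Proof.
move=> mf fn.
apply: (le_integrable _ (measurable_intr_EFin _ mf) _
  (finite_measure_integrable_cst mu n%:R measurableT)) => //.
move=> eta _ /=; rewrite lee_fin normr_nat -intr_norm.
by rewrite -[n%:R]/(n%:Z%:~R) ler_int.
Qed.

Lemma integrable_height : mu.-integrable setT (fun eta : configSpace => (eta 0)%:R%:E).
Proof.
apply/integrableP; split.
  apply: (measurable_intr_EFin (fun eta : configSpace => (eta 0)%:Z)) => B.
  exact: discretely_measurable_eval 0 [set k | B k%:Z].
under eq_integral do rewrite /= normr_nat.
by rewrite mean1 ltry.
Qed.

Lemma integrable1 : mu.-integrable [set: configSpace] (cst 1%E).
Proof. exact: (finite_measure_integrable_cst mu 1 measurableT). Qed.

Lemma gradient_translate a eta u x : stabilizes eta u ->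
  gradient (translate a eta) x = gradient eta (x + a).
Proof.
by move=> su; rewrite /gradient !(odometer_translate _ _ _ _ su) addrAC.
Qed.

(** The odometer's Laplacian at the origin, written as an increment of the stationary gradient. *)
Definition laplacian (eta : config) : int := gradient eta 1 - gradient eta 0.

Lemma discretely_measurable_laplacian :
  discretely_measurable (laplacian : configSpace -> int).
Proof.
move=> B.
exact: (discretely_measurable_pair _ _ (discretely_measurable_gradient 1)
  (discretely_measurable_gradient 0) [set y | B (y.1 - y.2)]).
Qed.

(** The lower bound comes from leastness, the upper one from stability. *)
Lemma laplacian_bounds eta u : stabilizes eta u ->
  - (eta 0)%:Z <= laplacian eta <= 1 - (eta 0)%:Z.
Proof.
move=> su; have := odometer_laplacian_ge0 _ _ 0 su.
have := odometer_stabilizes _ _ su 0; rewrite /stable_after.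
rewrite /laplacian /gradient subrr sub0r add0r.
move: (odometer _ _) (odometer _ _) (odometer _ _) (eta 0) => a b c d; lia.
Qed.

(** Almost surely the gradient at 1 is the gradient at 0 of the translated configuration, so the two
    bounded terms have equal integrals. *)
Lemma integral_clamped_laplacian n :
  (\int[mu]_eta
     (clamp n (gradient eta 1) - clamp n (gradient eta 0))%:~R%:E = 0)%E.
Proof.
have mc x : discretely_measurable (fun eta : configSpace => clamp n (gradient eta x)).
  by move=> B; exact: discretely_measurable_gradient x [set z | B (clamp n z)].
have ic x := integrable_bounded_int _ n (mc x) (fun eta => clamp_bounded n (gradient eta x)).
under eq_integral do rewrite rmorphB /= EFinB.
rewrite (integralB measurableT (ic 1) (ic 0)).
have ict : mu.-integrable setT
    ((fun eta : configSpace => (clamp n (gradient eta 0))%:~R%:E) \o translate 1).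
  apply: (integrable_bounded_int (fun eta => clamp n (gradient (translate 1 eta) 0)) n).
    move=> B; rewrite -[X in measurable X]setTI.
    exact: measurable_translate 1 measurableT _ (mc 0 B).
  by move=> eta; exact: clamp_bounded.
rewrite -(integral_translate 1 _ (measurable_intr_EFin _ (mc 0)) ict).
rewrite (@ae_eq_integral _ _ _ mu setT
  (fun eta => (clamp n (gradient (translate 1 eta) 0))%:~R%:E)
  (fun eta => (clamp n (gradient eta 1))%:~R%:E)) //.
- rewrite subee //; exact: integrable_fin_num ict.
- exact: measurable_intr_EFin.
- by have /integrableP[] := ict.
- apply: filterS ae_stabilizes => eta [u su] _.
  by rewrite (gradient_translate 1 _ _ 0 su).
Qed.

(* A stationary function with integrable increments has centred increments,
   even when it is not integrable itself: truncate and pass to the limit. *)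
Lemma integral_laplacian : mu.-integrable setT (fun eta : configSpace => (laplacian eta)%:~R%:E) /\
  (\int[mu]_eta (laplacian eta)%:~R%:E = 0)%E.
Proof.
pose F n (eta : configSpace) : \bar R :=
  (clamp n (gradient eta 1) - clamp n (gradient eta 0))%:~R%:E.
have mF n : measurable_fun [set: configSpace] (F n).
  apply: measurable_intr_EFin => B.
  exact: (discretely_measurable_pair _ _ (discretely_measurable_gradient 1)
    (discretely_measurable_gradient 0) [set y | B (clamp n y.1 - clamp n y.2)]).
have idom : mu.-integrable setT (fun eta : configSpace => (1 + (eta 0)%:R%:E)%E).
  have := integrableD measurableT integrable1 integrable_height; exact.
have [||il _ cvg] := dominated_convergence measurableT mF
    (measurable_intr_EFin _ discretely_measurable_laplacian) _ idom _.
(* Once [n] exceeds both gradients the truncation is inactive, so the sequence is eventually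
   constant. *)
- apply: nearW => eta _; apply: cvg_near_cst.
  exists (absz (gradient eta 1) + absz (gradient eta 0))%N => // n /= hn.
  by rewrite /F /laplacian !clamp_id //; lia.
(* The Lipschitz bound and [laplacian_bounds] give domination by [1 + eta 0]. *)
- apply: filterS ae_stabilizes => eta [u su] n _.
  rewrite -EFinD abse_EFin lee_fin -intr_norm -[1 + _]/(1%:~R + (eta 0)%:Z%:~R).
  rewrite -intrD ler_int; apply: le_trans (clamp_lipschitz _ _ _) _.
  by have := laplacian_bounds _ _ su; rewrite /laplacian; lia.
split=> //; apply/esym; apply: cvg_unique cvg => //.
rewrite (_ : (fun n => _) = cst 0%E); first exact: cvg_cst.
by apply/funext => n; exact: integral_clamped_laplacian.
Qed.

(** The deficit [D], one minus the final height at 0, is almost surely nonnegative and has mean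
    [1 - 1 - 0 = 0], so it vanishes almost surely. *)
Lemma ae_laplacian : {ae mu, forall eta : config, laplacian eta = 1 - (eta 0)%:Z}.
Proof.
have [il il0] := integral_laplacian.
pose D (eta : configSpace) := 1 - (eta 0)%:Z - laplacian eta.
have mD : discretely_measurable D.
  move=> B; exact: (discretely_measurable_pair _ _ (discretely_measurable_eval 0)
    discretely_measurable_laplacian [set y | B (1 - y.1%:Z - y.2)]).
have D0 : (\int[mu]_eta (D eta)%:~R%:E = 0)%E.
  transitivity (\int[mu]_eta cst 1 eta -
      \int[mu]_eta ((eta : configSpace) 0%:Z)%:R%:E -
      \int[mu]_eta (laplacian eta)%:~R%:E)%E.
    rewrite -(integralB measurableT integrable1 integrable_height).
    rewrite -(integralB measurableT (integrableB measurableT integrable1 integrable_height) il).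
    by apply: eq_integral => eta _; rewrite /D !rmorphB /= !EFinB.
  have mu1 : (\int[mu]_eta cst 1 eta = 1)%E.
    by rewrite integral_cst // mul1e; exact: probability_setT.
  by rewrite mu1 il0 mean1 subee // sube0.
have [] := ae_eq_integral_abs mu measurableT (measurable_intr_EFin _ mD).
case=> [|N [mN N0 DN]].
  rewrite -[RHS]D0; apply: ae_eq_integral => //.
  - by apply: measurableT_comp => //; exact: measurable_intr_EFin.
  - exact: measurable_intr_EFin.
  apply: filterS ae_stabilizes => eta [u su] _.
  rewrite abse_EFin -intr_norm ger0_norm //.
  by have := laplacian_bounds _ _ su; rewrite /D; lia.
move=> _; exists N; split=> // eta nl; apply: DN => /(_ Logic.I) [] /eqP.
by rewrite intr_eq0 subr_eq0 => /eqP De; apply: nl.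
Qed.

(** Translation carries the statement at the origin to every site, and countably many null sets have
    a null union. *)
Lemma ae_stabilizes_to_one : {ae mu, forall eta : config, stabilizes_to_one eta}.
Proof.
have aex : {ae mu, forall eta : config, forall n : nat,
    laplacian (translate n%:Z eta) = 1 - (eta n%:Z)%:Z /\
    laplacian (translate (- n%:Z) eta) = 1 - (eta (- n%:Z))%:Z}.
  have ae_at a : {ae mu, forall eta : config, laplacian (translate a eta) = 1 - (eta a)%:Z}.
    apply: filterS (ae_translate mu_iid a _ ae_laplacian) => eta ->.
    by rewrite /translate add0r.
  apply: ae_foralln => n; by apply: filterS2 (ae_at n%:Z) (ae_at (- n%:Z)) => eta.
apply: filterS2 ae_stabilizes aex => eta [u su] lap x.
have : laplacian (translate x eta) = 1 - (eta x)%:Z.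
  by case: (intP x) => [|n|n]; [have [] := lap 0%N|have [] := lap n.+1|have [] := lap n.+1].
rewrite /laplacian !(gradient_translate _ _ _ _ su) /gradient add0r.
rewrite (addrC 1) addrK.
by move: (odometer _ _) (odometer _ _) (odometer _ _) (eta x) => a b c d; lia.
Qed.

End StationaryGradient.

(** * Contradiction from two heights at the origin *)

Theorem theorem3p2 (R : realType) (mu : probability configSpace R)
  (p : nat -> R) :
  iid_product mu p ->
  (\int[mu]_eta ((eta : configSpace) 0%:Z)%:R%:E = 1)%E ->
  (0 < mu [set eta : configSpace | eta 0%:Z = 0%N])%E ->
  ~ {ae mu, forall eta : configSpace, stabilizable R eta}.
Proof.
move=> mu_iid mean1 mu0 ae_stab.
(* The final toppling counts of the procedure serve as [u]. *)
have ae_stabilizes : {ae mu, forall eta, exists u, stabilizes eta u}.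
  apply: filterS ae_stab => eta [f [_ [_ [u [_ su]]]]]; exists u => x.
  by have := su x; rewrite /stable_after; lia.
have ae_one := ae_stabilizes_to_one mu_iid mean1 ae_stabilizes.
have p0 : 0 < p 0%N by move: mu0; rewrite (mu_eval mu_iid) lte_fin.
(* Otherwise [eta 0] would vanish almost surely and the mean would be 0. *)
have [k k0 pk] : exists2 k, (0 < k)%N & 0 < p k.
  apply: contrapT => /forall2NP no.
  have height0 : {ae mu, forall eta : configSpace, forall k, (0 < k)%N -> eta 0 <> k}.
    apply: ae_foralln => k; exists [set eta : configSpace | (0 < k)%N /\ eta 0 = k].
    split; first exact: discretely_measurable_eval 0 [set j | (0 < k)%N /\ j = k].
      case: (posnP k) => [->|k0].
        by rewrite (_ : [set _ | _] = set0) ?measure0 //; apply/seteqP; split=> eta [].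
      rewrite (_ : [set _ | _] = [set eta : configSpace | eta 0 = k]).
        apply: etrans (mu_eval mu_iid 0 k) _; congr EFin; apply/eqP.
        have [//|/negP] := no k; rewrite -leNgt => pk.
        by rewrite eq_le pk (p_ge0 mu_iid).
      by apply/seteqP; split=> eta //= [].
    by move=> eta /= /not_implyP [k0 /contrapT].
  have : (\int[mu]_eta ((eta : configSpace) 0)%:R%:E = \int[mu]_eta cst 0 eta)%E.
    apply: ae_eq_integral => //.
      by have /integrableP[] := integrable_height mean1.
    by apply: filterS height0 => eta e _; case: (eta 0) e => // k /(_ k.+1 isT).
  by rewrite mean1 integral0 => /eqP; rewrite eqe oner_eq0.
(* Both properties hold almost surely, and an event of probability one is nonempty. *)
have [eta [one0 onek]] : exists eta,
    stabilizes_to_one (set_origin 0 eta) /\ stabilizes_to_one (set_origin k eta).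
  have mu_proper : ProperFilter (nbhs (almost_everywhere mu)).
    apply: ae_properfilter_algebraOfSetsType.
    by rewrite [X in (_ < X)%E]probability_setT lte_fin.
  exact: filter_ex (filterI (ae_set_origin mu_iid 0 _ p0 ae_one) (ae_set_origin mu_iid k _ pk ae_one)).
exact: stabilizes_to_one_set_origin k0 one0 onek.
Qed.
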